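(* Let $\overline{B}$ be an $\mathfrak{F}$-blocking set of $\Gamma'$ such that $\overline{B}\cap\Sigma=\Theta$, let $K=\mathfrak{K}(\Omega,\overline{B})$, and let $B=(K\setminus\Sigma)\cup\{X\}$, regarded as a set of points of $\Pi_r=PG(r,q^n)$. If $\overline{B}\setminus X$ is a minimal $\mathfrak{F}$-blocking set, then $B$ is a minimal blocking set of $\Pi_r$ (with respect to hyperplanes). If moreover $\overline{B}$ is non-trivial, then $B$ is also non-trivial.
   Context: All dimensions are projective. Let $q$ be a prime power, $r\ge 2$, $n\geq 2$. Let $\Sigma$ be a hyperplane of $PG(rn,q)$, so $\Sigma\cong PG(rn-1,q)$, and let $\mathcal{S}$ be a Desarguesian $(n-1)$-spread of $\Sigma$: identifying $\Sigma$ with the projective space of the $\mathbb{F}_q$-vector space $\mathbb{F}_{q^n}^r$, the elements of $\mathcal{S}$ are the $(n-1)$-dimensional subspaces given by the one-dimensional $\mathbb{F}_{q^n}$-subspaces of $\mathbb{F}_{q^n}^r$. Barlotti-Cofman representation: $\Pi_r\cong PG(r,q^n)$ is the geometry whose points are the points of $PG(rn,q)\setminus\Sigma$ (affine points) together with the elements of $\mathcal{S}$, and whose lines are the $n$-dimensional subspaces of $PG(rn,q)$ meeting $\Sigma$ exactly in an element of $\mathcal{S}$, together with the lines of $PG(\mathcal{S})\cong PG(r-1,q^n)$ (the spread elements contained in the span of two distinct elements of $\mathcal{S}$), with natural incidence. The hyperplanes of $\Pi_r$ are $PG(\mathcal{S})$ (whose points are all elements of $\mathcal{S}$) and those represented by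 an $(r-1)n$-dimensional subspace $S_{(r-1)n}$ of $PG(rn,q)$ not contained in $\Sigma$ such that $S_{(r-1)n}\cap\Sigma$ has dimension $(r-1)n-1$ and is a union of elements of $\mathcal{S}$; the points of such a hyperplane are the affine points in $S_{(r-1)n}$ and the spread elements contained in $S_{(r-1)n}$. Fix $X\in\mathcal{S}$ and a subspace $\Omega$ of $X$ of dimension $s\leq n-2$. Let $\Gamma$ be a subspace of $\Sigma$ with $\dim\Gamma=rn-s-2$ and $\Gamma\cap\Omega=\emptyset$, let $\Theta=\Gamma\cap X$, and let $\Gamma'$ be a subspace of $PG(rn,q)$ of dimension $rn-s-1$ with $\Gamma'\cap\Sigma=\Gamma$. $\mathfrak{F}=\{\langle S_{(r-1)n},\Omega\rangle\cap\Gamma' : S_{(r-1)n}\text{ a hyperplane of }\Pi_r\text{ not containing }X\}$; its members are $(r-1)n$-dimensional subspaces. A subset of $\Gamma'$ is an $\mathfrak{F}$-blocking set if it meets every member of $\mathfrak{F}$; it is minimal if no proper subset is an $\mathfrak{F}$-blocking set; it is trivial if it contains a subspace of dimension $(rn-s-1)-(r-1)n=n-s-1$. The cone is $\mathfrak{K}(\Omega,\overline{B})=\bigcup_{\overline{p}\in\overline{B}}\langle\overline{p},\Omega\rangle$. A blocking set of $\Pi_r$ is a set of points of $\Pi_r$ meeting every hyperplane of $\Pi_r$; it is minimal if no proper subset is a blocking set, and trivial if it contains a line of $\Pi_r$. *)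

(* Defs.v *)
From HB Require Import structures.
From mathcomp Require Import all_boot all_order all_algebra all_field.
From mathcomp Require Import boolp classical_sets.
Set Implicit Arguments.
Unset Strict Implicit.
Unset Printing Implicit Defensive.
Import Order.TTheory GRing.Theory Num.Theory.
Local Open Scope classical_set_scope.
Local Open Scope ring_scope.

(* A subspace of the projective space PG(W) is a linear subspace U of W; its
   projective dimension is integer-valued, the empty subspace 0 having
   dimension -1. *)
Definition pdim (F : fieldType) (W : vectType F) (U : {vspace W}) : int :=
  (\dim U)%:Z - 1.

Definition points (F : fieldType) (W : vectType F) (U : {vspace W}) :
    set {vspace W} :=
  [set p | pdim p = 0 /\ (p <= U)%VS].

Definition affine_points (F : fieldType) (W : vectType F)
    (Sigma : {vspace W}) : set {vspace W} :=
  points fullv `\` points Sigma.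

(* phi identifies L^r, seen as a vector space over F, with Sigma. *)
Definition field_reduction (F : fieldType) (L : fieldExtType F)
    (W : vectType F) (r : nat) (Sigma : {vspace W})
    (phi : 'rV[L]_r -> W) : Prop :=
  [/\ forall u v, phi (u + v) = phi u + phi v,
      forall (a : F) v, phi (a%:A *: v) = a *: phi v,
      injective phi
    & forall w, (w \in Sigma) <-> (exists v, w = phi v)].

Definition desarguesian_spread (F : fieldType) (L : fieldExtType F)
    (W : vectType F) (r : nat) (Sigma : {vspace W})
    (S : set {vspace W}) : Prop :=
  exists2 phi : 'rV[L]_r -> W, field_reduction Sigma phi &
    S = [set Y : {vspace W} | exists2 D : {vspace 'rV[L]_r}, pdim D = 0 &
                   forall w : W, (w \in Y) <-> (exists2 v, v \in D & w = phi v)].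

(* The Barlotti-Cofman geometry of (Sigma, S). All its points, lines and
   hyperplanes are represented by linear subspaces of W, and a point P lies
   on the line or hyperplane represented by U exactly when P is contained in
   U. *)
Definition bc_points (F : fieldType) (W : vectType F) (Sigma : {vspace W})
    (S : set {vspace W}) : set {vspace W} :=
  affine_points Sigma `|` S.

Definition bc_points_on (F : fieldType) (W : vectType F)
    (Sigma : {vspace W}) (S : set {vspace W}) (U : {vspace W}) :
    set {vspace W} :=
  [set P | bc_points Sigma S P /\ (P <= U)%VS].

Definition bc_line (F : fieldType) (W : vectType F) (n : nat)
    (Sigma : {vspace W}) (S : set {vspace W}) : set {vspace W} :=
  [set l | pdim l = n%:Z /\ S (l :&: Sigma)%VS] `|`
  [set l | exists Y Z, [/\ S Y, S Z, Y <> Z & l = (Y + Z)%VS]].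

(* The hyperplane PG(S) is represented by Sigma. *)
Definition bc_hyperplane (F : fieldType) (W : vectType F) (r n : nat)
    (Sigma : {vspace W}) (S : set {vspace W}) : set {vspace W} :=
  [set H | H = Sigma \/
    [/\ pdim H = ((r - 1) * n)%N%:Z,
        ~~ (H <= Sigma)%VS,
        pdim (H :&: Sigma) = ((r - 1) * n)%N%:Z - 1
      & exists2 T : set {vspace W}, T `<=` S &
          points (H :&: Sigma) = \bigcup_(Y in T) points Y]].

Definition blocking_set (T : Type) (E : set T) (A : set (set T))
    (B : set T) : Prop :=
  B `<=` E /\ forall a, A a -> B `&` a !=set0.

Definition minimal_blocking_set (T : Type) (E : set T) (A : set (set T))
    (B : set T) : Prop :=
  blocking_set E A B /\ forall C, C `<` B -> ~ blocking_set E A C.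

Definition bc_minimal_blocking_set (F : fieldType) (W : vectType F)
    (r n : nat) (Sigma : {vspace W}) (S : set {vspace W}) :
    set {vspace W} -> Prop :=
  minimal_blocking_set (bc_points Sigma S)
    [set bc_points_on Sigma S H | H in bc_hyperplane r n Sigma S].

Definition bc_trivial (F : fieldType) (W : vectType F) (n : nat)
    (Sigma : {vspace W}) (S B : set {vspace W}) : Prop :=
  exists2 l, bc_line n Sigma S l & bc_points_on Sigma S l `<=` B.

Definition frakF (F : fieldType) (W : vectType F) (r n : nat)
    (Sigma : {vspace W}) (S : set {vspace W}) (X Omega Gamma' : {vspace W}) :
    set {vspace W} :=
  [set ((H + Omega) :&: Gamma')%VS
     | H in [set H | bc_hyperplane r n Sigma S H /\ ~~ (X <= H)%VS]].

Definition frakF_blocking_set (F : fieldType) (W : vectType F) (r n : nat)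
    (Sigma : {vspace W}) (S : set {vspace W}) (X Omega Gamma' : {vspace W}) :
    set {vspace W} -> Prop :=
  blocking_set (points Gamma')
    [set points A | A in frakF r n Sigma S X Omega Gamma'].

Definition frakF_minimal_blocking_set (F : fieldType) (W : vectType F)
    (r n : nat) (Sigma : {vspace W}) (S : set {vspace W})
    (X Omega Gamma' : {vspace W}) : set {vspace W} -> Prop :=
  minimal_blocking_set (points Gamma')
    [set points A | A in frakF r n Sigma S X Omega Gamma'].

(* The members of frakF have dimension (r - 1) n. *)
Definition frakF_trivial (F : fieldType) (W : vectType F) (r n : nat)
    (Gamma' : {vspace W}) (B : set {vspace W}) : Prop :=
  exists2 U : {vspace W}, pdim U = pdim Gamma' - ((r - 1) * n)%N%:Z &
    points U `<=` B.

Definition cone (F : fieldType) (W : vectType F) (Omega : {vspace W})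
    (B : set {vspace W}) : set {vspace W} :=
  \bigcup_(p in B) points (p + Omega)%VS.

(* Main.v *)
(* Every w in W decomposes along W = Gamma' (+) Omega, and a hyperplane H off X
   meets X trivially, so a point of Bbar off X lying in <H, Omega> lifts to a
   unique affine point of H inside the cone; this gives blocking.  For minimality,
   a member of frakF tangent to Bbar \ X at p comes from some H, and replacing
   H by <H :&: Sigma, P>, for P any affine point of <p, Omega>, changes neither
   <H, Omega> nor H :&: Sigma and yields a hyperplane tangent to B at P; Sigma
   itself is tangent at X.  A line inside B must pass through X, hence contains
   Omega, and its trace on Gamma' lies in Bbar. *)
Require Import Defs.
From HB Require Import structures.
From mathcomp Require Import all_boot all_order all_algebra all_field.
From mathcomp Require Import boolp classical_sets.
From mathcomp Require Import zify.
Set Implicit Arguments.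
Unset Strict Implicit.
Unset Printing Implicit Defensive.
Import Order.TTheory GRing.Theory Num.Theory.
Local Open Scope classical_set_scope.
Local Open Scope ring_scope.

(** * Minimality of blocking sets through tangents *)

Section Blocking.
Variables (T : Type) (E : set T) (A : set (set T)).

(** If no member of [A] is tangent at [x], then [x] can be deleted. Conversely, a blocking subset
    meets the tangent at [x] only in [x], hence contains [x]. *)
Lemma minimal_blocking_setP (D : set T) :
  minimal_blocking_set E A D <->
  blocking_set E A D /\
  forall x, D x -> exists2 a, A a & D `&` a `<=` [set x].
Proof.
split=> [[bD minD]|[bD tgD]]; split=> //.
- move=> x Dx; apply: contrapT => no_tg.
  apply: (minD (D `\ x)); first by split=> [y []//|/(_ x Dx) [_]]; apply.
  split=> [y [Dy _]|a Aa]; first by case: bD => + _; apply.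
  apply: contrapT => Da0; apply: no_tg; exists a => // y [Dy ay].
  by apply: contrapT => yx; apply: Da0; exists y.
- move=> C [CD nDC] [_ bC]; apply: nDC => x Dx.
  have [a Aa tga] := tgD x Dx.
  have [y [Cy ay]] := bC a Aa.
  by rewrite -(tga y _) //; split=> //; apply: CD.
Qed.

End Blocking.

(** * Projective points as linear subspaces: exchange and projection from a vertex *)

Section Points.
Variables (F : fieldType) (W : vectType F).
Implicit Types (A U V O p P Q : {vspace W}).

Lemma dim_pdim U (d : int) : pdim U = d -> (\dim U)%:Z = d + 1.
Proof. by move=> <-; rewrite subrK. Qed.

Lemma pdim0E p : (pdim p = 0) <-> (\dim p = 1%N).
Proof. by rewrite /pdim; split; lia. Qed.

Lemma pdim_vline (w : W) : w != 0 -> pdim <[w]> = 0.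
Proof. by move=> w0; apply/pdim0E; rewrite dim_vline w0. Qed.

Lemma pdim0_vline p : pdim p = 0 -> exists2 w, w != 0 & p = <[w]>%VS.
Proof.
move=> /pdim0E p1; exists (vpick p); first by rewrite vpick0 -dimv_eq0 p1.
apply/esym/eqP; rewrite eqEdim -memvE memv_pick p1 dim_vline vpick0.
by rewrite -dimv_eq0 p1.
Qed.

Lemma points_subvP U V : points U `<=` points V <-> (U <= V)%VS.
Proof.
split=> [UV|UV p [p0 pU]]; last by split=> //; apply: subv_trans UV.
apply/subvP => w wU; have [->|w0] := eqVneq w 0; first exact: mem0v.
by have [] := UV <[w]>%VS; rewrite /points /= -?memvE //; split=> //; apply: pdim_vline.
Qed.

Lemma capv_point0 p U : pdim p = 0 -> ~~ (p <= U)%VS -> (p :&: U = 0)%VS.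
Proof.
move=> /pdim0E p1 pU; apply/eqP; rewrite -dimv_eq0 -leqn0 -ltnS -p1 ltn_neqAle.
rewrite dimvS ?capvSl // andbT; apply: contra pU => /eqP e.
by apply/capv_idPl/eqP; rewrite eqEdim capvSl e leqnn.
Qed.

(** [O] has codimension at most one in [p + O], so nothing lies strictly between them and [Q + O] is
    all of [p + O]. *)
Lemma point_exchange p Q O : pdim p = 0 -> (Q <= p + O)%VS -> ~~ (Q <= O)%VS ->
  (p <= Q + O)%VS.
Proof.
move=> /pdim0E p1 QpO QO.
have sub : (Q + O <= p + O)%VS by rewrite subv_add QpO addvSr.
suff /eqP -> : (Q + O == p + O)%VS by exact: addvSl.
rewrite eqEdim sub (leq_trans (dimv_add_leqif p O)) // p1 add1n ltnNge.
apply: contra QO => h.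
suff /eqP -> : (O == Q + O)%VS by exact: addvSl.
by rewrite eqEdim addvSr.
Qed.

(** Being disjoint from [O], the subspace [A :&: (p + O)] has vector dimension at most one, so it is
    at most a single point. *)
Lemma point_lift_unique p P Q A O : pdim p = 0 -> pdim P = 0 -> pdim Q = 0 ->
  (A :&: O = 0)%VS -> (P <= A)%VS -> (Q <= A)%VS ->
  (P <= p + O)%VS -> (Q <= p + O)%VS -> P = Q.
Proof.
move=> /pdim0E p1 /pdim0E P1 /pdim0E Q1 AO PA QA PpO QpO.
set M := (A :&: (p + O))%VS.
have M1 : (\dim M <= 1)%N.
  have MO : (M :&: O = 0)%VS.
    by apply/eqP; rewrite -subv0 -AO capvS // capvSl.
  rewrite -(leq_add2r (\dim O)) -dimv_disjoint_sum //.
  rewrite (leq_trans _ (_ : \dim (p + O) <= _)%N) //; last first.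
    by rewrite -p1 dimv_add_leqif.
  by rewrite dimvS // subv_add capvSr addvSr.
suff E R : \dim R = 1%N -> (R <= A)%VS -> (R <= p + O)%VS -> R = M.
  by rewrite (E P) // (E Q).
by move=> R1 RA RpO; apply/eqP; rewrite eqEdim subv_cap RA RpO R1.
Qed.

End Points.

(** * The spread and the hyperplanes that miss one of its elements *)

Section Spread.
Variables (F : fieldType) (L : fieldExtType F) (W : vectType F) (r n : nat).
Variables (Sigma : {vspace W}) (S : set {vspace W}).
Hypothesis spreadS : desarguesian_spread L r Sigma S.

Lemma spread_sub Y : S Y -> (Y <= Sigma)%VS.
Proof.
case: spreadS => phi [_ _ _ imphi] -> [D _ YD]; apply/subvP => w /YD[v _ ->].
by apply/imphi; exists v.
Qed.

(** By injectivity of [phi], a common nonzero vector has one preimage, which spans both underlying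
    one-dimensional [L]-subspaces. *)
Lemma spread_disjoint Y Z w : S Y -> S Z -> w != 0 -> w \in Y -> w \in Z -> Y = Z.
Proof.
case: spreadS => phi [phiD _ phi_inj _] -> [D D1 YD] [D' D'1 ZD'] w0.
move=> /YD[v vD ew] /ZD'[v' v'D'] ew'.
have evv' : v = v' by apply: phi_inj; rewrite -ew.
have phi0 : phi 0 = 0 by apply: (addIr (phi 0)); rewrite -phiD !add0r.
have v0 : v != 0 by apply: contraNneq w0 => v0; rewrite ew v0 phi0.
have lineE (G : {vspace 'rV[L]_r}) : pdim G = 0 -> v \in G -> G = <[v]>%VS.
  move=> /pdim0E G1 vG; apply/esym/eqP.
  by rewrite eqEdim -memvE vG G1 dim_vline v0.
have eD : D = D' by rewrite (lineE D) // (lineE D') // evv'.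
apply/vspaceP => u; apply/idP/idP.
- by move=> /YD; rewrite eD => /ZD'.
- by move=> /ZD'; rewrite -eD => /YD.
Qed.

(** A common nonzero vector would lie in a spread element inside [H]; by disjointness that element
    is [X]. *)
Lemma bc_hyperplane_cap0 H X : S X -> bc_hyperplane r n Sigma S H ->
  ~~ (X <= H)%VS -> (H :&: X = 0)%VS.
Proof.
move=> SX hH XH.
case: hH => [eH|[_ _ _ [T TS HT]]]; first by rewrite eH spread_sub in XH.
apply/eqP; rewrite -subv0; apply/subvP => w; rewrite memv_cap => /andP[wH wX].
apply: contraR XH; rewrite memv0 => w0.
have : points (H :&: Sigma)%VS <[w]>%VS.
  split; first exact: pdim_vline.
  by rewrite -memvE memv_cap wH (subvP (spread_sub SX)).
rewrite HT => -[Y TY [_]]; rewrite -memvE => wY.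
have eY := spread_disjoint (TS _ TY) SX w0 wY wX.
suff : (X <= H :&: Sigma)%VS by rewrite subv_cap => /andP[].
by apply/points_subvP; rewrite HT => p Xp; exists Y => //; rewrite eY.
Qed.

End Spread.

Theorem theorem5 (F : finFieldType) (L : fieldExtType F) (W : vectType F)
    (r n : nat) (s : int) (hr : (2 <= r)%N) (hn : (2 <= n)%N)
    (hL : \dim {:L} = n)
    (hW : pdim {:W} = (r * n)%N%:Z)
    (Sigma : {vspace W}) (hSigma : pdim Sigma = (r * n)%N%:Z - 1)
    (S : set {vspace W}) (hS : desarguesian_spread L r Sigma S)
    (X : {vspace W}) (hX : S X)
    (Omega : {vspace W}) (hOmegaX : (Omega <= X)%VS)
    (hOmega : pdim Omega = s) (hs : s <= n%:Z - 2)
    (Gamma : {vspace W}) (hGammaSigma : (Gamma <= Sigma)%VS)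
    (hGamma : pdim Gamma = (r * n)%N%:Z - s - 2)
    (hGammaOmega : (Gamma :&: Omega)%VS = 0%VS)
    (Theta : {vspace W}) (hTheta : Theta = (Gamma :&: X)%VS)
    (Gamma' : {vspace W}) (hGamma' : pdim Gamma' = (r * n)%N%:Z - s - 1)
    (hGamma'Sigma : (Gamma' :&: Sigma)%VS = Gamma)
    (Bbar : set {vspace W})
    (hBbar : frakF_blocking_set r n Sigma S X Omega Gamma' Bbar)
    (hBbarSigma : Bbar `&` points Sigma = points Theta)
    (K : set {vspace W}) (hK : K = cone Omega Bbar)
    (B : set {vspace W}) (hB : B = (K `\` points Sigma) `|` [set X])
    (hmin : frakF_minimal_blocking_set r n Sigma S X Omega Gamma'
              (Bbar `\` points X)) :
  bc_minimal_blocking_set r n Sigma S B /\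
  (~ frakF_trivial r n Gamma' Bbar -> ~ bc_trivial n Sigma S B).
Proof.
have SSig := spread_sub hS.
have XSig := SSig _ hX.
have OSig := subv_trans hOmegaX XSig.
have GO : (Gamma' :&: Omega = 0)%VS.
  apply/eqP; rewrite -subv0 -hGammaOmega -hGamma'Sigma -capvA capvS //.
  by rewrite subv_cap OSig subvv.
have [BbarG _] := hBbar.
have [[_ BbarX_block] BbarX_tg] := (minimal_blocking_setP _ _ _).1 hmin.
have BbarX p : Bbar p -> (p <= Sigma)%VS -> (p <= X)%VS.
  move=> Bp pSig; have [p0 _] := BbarG p Bp.
  have : (Bbar `&` points Sigma) p by split.
  by rewrite hBbarSigma hTheta => -[_]; rewrite subv_cap => /andP[].
(* The base point [p] of a generator carrying an affine point avoids [X], since otherwise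
   [p + Omega] would lie in [Sigma]. Exchange also recovers [p] from [P]. *)
have affineB P : B P -> P <> X -> [/\ pdim P = 0, ~~ (P <= Sigma)%VS &
    exists p, [/\ [/\ Bbar p, pdim p = 0 & (p <= Gamma')%VS], ~~ (p <= X)%VS,
                (P <= p + Omega)%VS & (p <= P + Omega)%VS]].
  rewrite hB => -[[KP nP]|//] _; move: KP; rewrite hK => -[p Bp [P0 PpO]].
  have PSig : ~~ (P <= Sigma)%VS by apply/negP => PS; apply: nP.
  have [p0 pG] := BbarG p Bp.
  split=> //; exists p; split=> //.
    apply: contra PSig => pX; apply: subv_trans PpO _.
    by rewrite subv_add OSig (subv_trans pX).
  by apply: point_exchange => //; apply: contra PSig => /subv_trans; apply.
have BX : B X by rewrite hB; right.
split.
- apply/minimal_blocking_setP; split; first split.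
  + move=> P; have [->|PX] := pselect (P = X); first by right.
    move=> /affineB /(_ PX) [P0 PSig _]; left; split; first by split; rewrite ?subvf.
    by case=> _; apply/negP.
  + move=> _ [H hH <-].
    have [XH|XH] := boolP (X <= H)%VS.
      by exists X; split=> //; split=> //; right.
    have [|p [[Bp npX] [p0]]] := BbarX_block (points ((H + Omega) :&: Gamma')%VS).
      by exists ((H + Omega) :&: Gamma')%VS => //; exists H.
    rewrite subv_cap => /andP[pHO pG].
    have pSig : ~~ (p <= Sigma)%VS.
      by apply/negP => /(BbarX _ Bp) pX; apply: npX.
    have [w w0 ep] := pdim0_vline p0.
    move: pHO pSig; rewrite ep -!memvE => /memv_addP[h hh [o oO ew]] wSig.
    (* The lift of [p] to [H] is spanned by [h = w - o]; it is affine because [w] is outside [Sigma]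
       while [o] is inside. *)
    have hSig : h \notin Sigma.
      by apply: contra wSig => hSig; rewrite ew memvD // (subvP OSig).
    have h0 : h != 0 by apply: contraNneq hSig => ->; apply: mem0v.
    have Ph := pdim_vline h0.
    exists <[h]>%VS; split; last first.
      split; last by rewrite -memvE.
      left; split; first by split; rewrite ?subvf.
      by case=> _; rewrite -memvE; apply/negP.
    rewrite hB; left; split; last by case=> _; rewrite -memvE; apply/negP.
    rewrite hK; exists p => //; split=> //.
    rewrite -memvE ep; have -> : h = w - o by rewrite ew addrK.
    by rewrite memvB ?(subvP (addvSl _ _) _ (memv_line w)) ?(subvP (addvSr _ _) _ oO).
  + move=> P BP; have [->|PX] := pselect (P = X).
      exists (bc_points_on Sigma S Sigma); first by exists Sigma => //; left.
      move=> Q [BQ [_ QSig]]; apply: contrapT => QX.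
      by have [_ + _] := affineB Q BQ QX; rewrite QSig.
    have [P0 PSig [p [[Bp p0 pG] npX PpO pPO]]] := affineB P BP PX.
    have [|_ [_ [H [hH XH] <-] <-] tg] := BbarX_tg p.
      by split=> // -[_]; apply/negP.
    have HX := bc_hyperplane_cap0 hS hX hH XH.
    have HO : (H :&: Omega = 0)%VS.
      by apply/eqP; rewrite -subv0 -HX capvS.
    (* Tangency only says that no point other than [p] is met; blocking supplies a point [q], which
       must then be [p]. *)
    have [|q [[Bq nqX] Hq]] := BbarX_block (points ((H + Omega) :&: Gamma')%VS).
      by exists ((H + Omega) :&: Gamma')%VS => //; exists H.
    have pHO : (p <= H + Omega)%VS.
      rewrite -(tg q) //; case: Hq => _; rewrite subv_cap => /andP[] //.
    case: (hH) => [eH|[pH HSig pHS [T TS HT]]]; first by rewrite eH XSig in XH.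
    set H0 := (H :&: Sigma)%VS in pHS HT.
    have dH : \dim H = (\dim H0).+1.
      by have := dim_pdim pH; have := dim_pdim pHS; clear; lia.
    (* Keeping the trace [H0] at infinity makes [H'] again a hyperplane off [X], now passing through
       [P]. *)
    set H' := (H0 + P)%VS.
    have H0P : (H0 :&: P = 0)%VS.
      rewrite capvC; apply: capv_point0 => //.
      by apply: contra PSig => /subv_trans; apply; apply: capvSr.
    have dH' : \dim H' = \dim H.
      rewrite dimv_disjoint_sum // (pdim0E P).1 //.
      by rewrite addn1.
    have H'Sig : (H' :&: Sigma = H0)%VS.
      apply/esym/eqP; rewrite eqEdim subv_cap addvSl capvSr /=.
      have : (\dim (H' :&: Sigma) < \dim H')%N.
        rewrite ltn_neqAle dimvS ?capvSl // andbT.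
        apply: contra PSig => /eqP e.
        have /eqP e' : (H' :&: Sigma == H')%VS by rewrite eqEdim capvSl e leqnn.
        by rewrite (subv_trans _ (capvSr H' Sigma)) // e' addvSr.
      by rewrite dH' dH ltnS.
    have XH' : ~~ (X <= H')%VS.
      apply: contra XH => XH'; apply: subv_trans (capvSl H Sigma).
      by rewrite -/H0 -H'Sig subv_cap XH'.
    have hH' : bc_hyperplane r n Sigma S H'.
      right; split.
      * by rewrite /pdim dH'.
      * by apply: contra PSig; apply: subv_trans; apply: addvSr.
      * by rewrite H'Sig.
      * by exists T => //; rewrite H'Sig.
    have H'X := bc_hyperplane_cap0 hS hX hH' XH'.
    have H'O : (H' :&: Omega = 0)%VS.
      by apply/eqP; rewrite -subv0 -H'X capvS.
    (* One inclusion suffices: [H] and [H'] have equal dimension and both are disjoint from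
       [Omega]. *)
    have eHO : (H' + Omega = H + Omega)%VS.
      apply/eqP; rewrite eqEdim (dimv_disjoint_sum HO) (dimv_disjoint_sum H'O) dH' leqnn andbT.
      rewrite !subv_add addvSr !andbT (subv_trans (capvSl _ _)) ?addvSl //=.
      by apply: subv_trans PpO _; rewrite subv_add pHO addvSr.
    exists (bc_points_on Sigma S H'); first by exists H'.
    move=> Q [BQ [_ QH']].
    have QX : Q <> X by move=> QX; rewrite -QX QH' in XH'.
    have [Q0 QSig [q' [[Bq' q'0 q'G] nq'X QqO qQO]]] := affineB Q BQ QX.
    (* The base point of [Q] lies in the same tangent member, so [P] and [Q] share the generator
       [p + Omega], which [H'] meets in at most one point. *)
    have eq' : q' = p.
      apply: (tg q'); split; first by split=> // -[_]; apply/negP.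
      split=> //; rewrite subv_cap q'G andbT -eHO (subv_trans qQO) //.
      by rewrite subv_add (subv_trans QH') ?addvSl ?addvSr.
    rewrite eq' in QqO.
    by apply: (point_lift_unique p0) QH' _ QqO PpO => //; apply: addvSr.
- move=> ntriv [l hl lB]; apply: ntriv.
  (* A line of PG(S) has two distinct spread elements, but [X] is the only spread element in [B]. *)
  case: hl => [[dl Sl]|[Y [Z [SY SZ YZ el]]]]; last first.
    have inX V : S V -> (V <= l)%VS -> V = X.
      move=> SV Vl; apply: contrapT => VX.
      have [|_ + _] := affineB V _ VX; last by rewrite SSig.
      by apply: lB; split=> //; right.
    have YX : Y = X by apply: inX => //; rewrite el addvSl.
    have ZX : Z = X by apply: inX => //; rewrite el addvSr.
    by case: YZ; rewrite YX ZX.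
  have elX : (l :&: Sigma = X)%VS.
    apply: contrapT => VX.
    have [|_ + _] := affineB _ _ VX; last by rewrite capvSr.
    by apply: lB; split; [right|apply: capvSl].
  have Ol : (Omega <= l)%VS by rewrite (subv_trans hOmegaX) // -elX capvSl.
  (* As [l] contains [Omega], it spans the whole space with [Gamma']; the Grassmann formula gives
     projective dimension [n - s - 1] for the intersection. *)
  exists (l :&: Gamma')%VS.
    have GOW : (Gamma' + Omega = fullv)%VS.
      apply/eqP; rewrite eqEdim subvf dimv_disjoint_sum //.
      have := dim_pdim hW; have := dim_pdim hGamma'; have := dim_pdim hOmega.
      by clear; lia.
    have lG : (l + Gamma' = fullv)%VS.
      apply/eqP; rewrite eqEsubv subvf -GOW.
      by rewrite subv_add addvSr (subv_trans Ol) ?addvSl.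
    have := dimv_sum_cap l Gamma'; rewrite lG.
    have ern : (r * n = (r - 1) * n + n)%N by rewrite -mulSnr subn1 prednK // ltnW.
    have := dim_pdim dl; have := dim_pdim hW; have := dim_pdim hGamma'.
    by rewrite /pdim ern; clear; lia.
  move=> P [P0]; rewrite subv_cap => /andP[Pl PG].
  (* At infinity, [P] lies in [Gamma :&: X], which is [Theta]. If affine, [P] shares a generator
     with some [p] of [Bbar], and [Gamma'] meets that generator only once, so [P = p]. *)
  have [PSig|PSig] := boolP (P <= Sigma)%VS.
    have : points Theta P.
      split=> //; rewrite hTheta -hGamma'Sigma -elX !subv_cap PG PSig.
      by rewrite Pl.
    by rewrite -hBbarSigma => -[].
  have PX : P <> X by move=> PX; rewrite PX XSig in PSig.
  have [|_ _ [p [[Bp p0 pG] npX PpO pPO]]] := affineB P _ PX.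
    apply: lB; split=> //; left; split; first by split; rewrite ?subvf.
    by case=> _; apply/negP.
  by rewrite (point_lift_unique p0 P0 p0 GO PG pG PpO (addvSl _ _)).
Qed.
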